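(* Let $n\ge 1$ and $d\ge 0$ be integers, let $\Xi=\{\xi_i\}_{i=1}^N\subset\mathbb{R}^n$ be a unisolvent set for $\mathbb{P}_d(\mathbb{R}^n)$, and let $r>0$. Let $p\in\mathbb{P}_d(\mathbb{R}^n)$. If $$\int_{B^n(\xi_i,r)} p(x_1,\ldots,x_n)\,\mathrm{d}x_1\cdots\mathrm{d}x_n=0\qquad\text{for every } i=1,\ldots,N,$$ then $p=0$.
   Context: $\mathbb{P}_d(\mathbb{R}^n)$ denotes the space of real polynomials in $n$ variables of total degree at most $d$. A finite set $\Xi\subset\mathbb{R}^n$ is unisolvent for $\mathbb{P}_d(\mathbb{R}^n)$ if the number $N$ of its points equals $\dim\mathbb{P}_d(\mathbb{R}^n)$ and the only $q\in\mathbb{P}_d(\mathbb{R}^n)$ with $q(\xi)=0$ for all $\xi\in\Xi$ is $q=0$. For $\mathbf{c}\in\mathbb{R}^n$ and $r>0$, $B^n(\mathbf{c},r)=\{\mathbf{x}\in\mathbb{R}^n : \|\mathbf{x}-\mathbf{c}\|_2\le r\}$ is the closed Euclidean ball. *)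

(* Defs.v *)
From HB Require Import structures.
From mathcomp Require Import all_boot all_order all_algebra finmap.
(* The notations of mpoly clash with those of MathComp-Analysis. *)
From mathcomp Require Import -(notations) mpoly.
From mathcomp Require Import all_classical all_reals all_analysis.

Set Implicit Arguments.
Unset Strict Implicit.
Unset Printing Implicit Defensive.

Import Order.TTheory GRing.Theory Num.Theory.
Import numFieldNormedType.Exports.
Local Open Scope classical_set_scope.
Local Open Scope ring_scope.

(* [polyle n R d] is the vector space P_d(R^n). Recall that [msize p] is the
   total degree of [p] plus one, and 0 for [p = 0]. *)
Section PolyLe.
Context (n : nat) (R : nzRingType) (d : nat).

Definition deg_le : {pred mpoly n R} := [pred p | (msize p <= d.+1)%N].

Lemma deg_le_submod_closed : submod_closed deg_le.
Proof.
split=> [|c p q]; first by rewrite inE msize0.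
rewrite !inE => hp hq; apply: (leq_trans (msizeD_le _ _)).
by rewrite geq_max hq andbT (leq_trans (msizeZ_le _ _)).
Qed.

HB.instance Definition _ :=
  GRing.isSubmodClosed.Build R (mpoly n R) deg_le deg_le_submod_closed.

Record polyle :=
  PolyLe { mpoly_of_polyle :> mpoly n R; _ : mpoly_of_polyle \in deg_le }.

HB.instance Definition _ := [isSub for mpoly_of_polyle].
HB.instance Definition _ := [Choice of polyle by <:].
HB.instance Definition _ := [SubChoice_isSubLmodule of polyle by <:].

Lemma polyle_vecaxiom : vector_axiom #|{: bmultinom n d.+1}| polyle.
Proof.
pose f (p : polyle) : 'rV[R]_#|{: bmultinom n d.+1}| :=
  \row_i mcoeff (bmnm (enum_val i)) (val p).
exists f => [c p q|].
  by apply/rowP => i; rewrite !mxE linearP.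
have gP (v : 'rV[R]_#|{: bmultinom n d.+1}|) :
    \sum_i v 0 i *: mpolyX R (bmnm (enum_val i)) \in deg_le.
  apply: rpred_sum => i _; apply: rpredZ.
  by rewrite inE msizeX ltnS -ltnS bmdeg.
exists (fun v => PolyLe (gP v)) => [p|v].
  apply: val_inj => /=; have := valP p; rewrite inE => hp.
  rewrite [RHS](mpolywE hp).
  rewrite [RHS](reindex (enum_val : 'I_#|{: bmultinom n d.+1}| -> _)) /=; last first.
    by apply/onW_bij/enum_val_bij.
  by apply: eq_bigr => i _; rewrite mxE.
apply/rowP => i; rewrite mxE /= raddf_sum /= (bigD1 i) //= big1 ?addr0.
  by rewrite mcoeffZ mcoeffX eqxx mulr1.
move=> j ji; rewrite mcoeffZ mcoeffX.
case: eqP => [/val_inj/enum_val_inj ij|_]; last by rewrite mulr0.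
by rewrite ij eqxx in ji.
Qed.

HB.instance Definition _ := Lmodule_hasFinDim.Build R polyle polyle_vecaxiom.

End PolyLe.

Definition unisolvent (n : nat) (R : realType) (d : nat)
    (Xi : {fset n.-tuple R}) : Prop :=
  #|` Xi| = \dim {: polyle n R d} /\
  forall q : polyle n R d,
    (forall xi : n.-tuple R, xi \in Xi -> meval (tnth xi) q = 0) -> q = 0.

Definition eball (n : nat) (R : realType) (c : n.-tuple R) (r : R) :
    set (n.-tuple R) :=
  [set x | Num.sqrt (\sum_(i < n) (tnth x i - tnth c i) ^+ 2) <= r].

Section SigmaFinitePack.
Context d (T : measurableType d) (R : realType).
Context (nu : {measure set T -> \bar R}).
Hypothesis nu_sf : sigma_finite setT nu.

Let nu' : set T -> \bar R := nu.
#[local] HB.instance Definition _ := Measure.on nu'.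
#[local] HB.instance Definition _ := Measure_isSigmaFinite.Build _ _ _ nu' nu_sf.

Lemma sigma_finite_pack :
  exists mu : {sigma_finite_measure set T -> \bar R}, mu = nu :> (set T -> \bar R).
Proof. by exists nu'. Qed.

End SigmaFinitePack.

(* Lebesgue measure on R^n, for the product sigma-algebra on tuples, as the
   n-fold product of the Lebesgue measure on R. *)
Section LebesgueTuple.
Context (R : realType).
Local Open Scope ereal_scope.

Definition tcons (n : nat) (x : measurableTypeR R * n.-tuple (measurableTypeR R)) :
  n.+1.-tuple (measurableTypeR R) := [tuple of x.1 :: x.2].

Fixpoint lebesgue_tuple (n : nat) :
    set (n.-tuple (measurableTypeR R)) -> \bar R :=
  match n with
  | 0 => dirac [tuple]
  | m.+1 => pushforward (@lebesgue_measure R \x @lebesgue_tuple m) (@tcons m)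
  end.

Lemma measurable_tcons n : measurable_fun [set: _] (@tcons n).
Proof. exact: measurable_cons. Qed.

Let tuncons n (t : n.+1.-tuple (measurableTypeR R)) := (thead t, [tuple of behead t]).

Let tunconsK n : cancel (@tcons n) (@tuncons n).
Proof. by move=> [x t]; rewrite /tuncons theadE; congr pair; apply: val_inj. Qed.

Let measurable_tuncons n : measurable_fun [set: _] (@tuncons n).
Proof.
apply/measurable_fun_pairP; split => /=; first exact: measurable_tnth.
exact: measurable_behead.
Qed.

Let lebesgue_tuple_spec n :
  exists mu : {sigma_finite_measure set (n.-tuple (measurableTypeR R)) -> \bar R},
    mu = @lebesgue_tuple n :> (set _ -> \bar R).
Proof.
elim: n => [|n [mu muE]].
  by exists (dirac (([tuple] : 0.-tuple (measurableTypeR R)))).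
pose m1 : {sigma_finite_measure set (measurableTypeR R) -> \bar R} :=
  @lebesgue_measure R.
pose nu :=
  measure_function_pushforward__canonical__measure_function_Measure
    (m1 \x mu) (@measurable_tcons n).
have sf : sigma_finite setT nu.
  have /sigma_finiteP[F [FT ndF Foo]] := sigma_finiteT m1.
  have /sigma_finiteP[G [GT ndG Goo]] := sigma_finiteT mu.
  exists (fun k => @tuncons n @^-1` (F k `*` G k)).
    apply/esym/seteqP; split => // t _.
    have [k _ Fk] : (\bigcup_i F i) (tuncons t).1 by rewrite -FT.
    have [l _ Gl] : (\bigcup_i G i) (tuncons t).2 by rewrite -GT.
    exists (maxn k l) => //; split.
      by move: Fk; exact/subsetPset/ndF/leq_maxl.
    by move: Gl; exact/subsetPset/ndG/leq_maxr.
  move=> k; have [mF Fk] := Foo k; have [mG Gk] := Goo k; split.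
    rewrite -[X in measurable X]setTI; apply: measurable_tuncons => //.
    exact: measurableX.
  rewrite /= /pushforward -comp_preimage (_ : _ \o _ = id).
    rewrite preimage_id product_measure1E//.
    by rewrite lte_mul_pinfty// ge0_fin_numE.
  by apply/funext => x /=; rewrite tunconsK.
have [nu' nu'E] := sigma_finite_pack sf.
by exists nu'; rewrite nu'E /= muE.
Qed.

Section instances.
Context (n : nat).

Let lebesgue_tuple0 : @lebesgue_tuple n set0 = 0.
Proof. by have [mu <-] := lebesgue_tuple_spec n; exact: measure0. Qed.

Let lebesgue_tuple_ge0 A : 0 <= @lebesgue_tuple n A.
Proof. by have [mu <-] := lebesgue_tuple_spec n; exact: measure_ge0. Qed.

Let lebesgue_tuple_sigma_additive : semi_sigma_additive (@lebesgue_tuple n).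
Proof.
by have [mu <-] := lebesgue_tuple_spec n; exact: measure_semi_sigma_additive.
Qed.

HB.instance Definition _ := isMeasure.Build _ _ _ (@lebesgue_tuple n)
  lebesgue_tuple0 lebesgue_tuple_ge0 lebesgue_tuple_sigma_additive.

Let lebesgue_tuple_sigma_finite : sigma_finite setT (@lebesgue_tuple n).
Proof. by have [mu <-] := lebesgue_tuple_spec n; exact: sigma_finiteT. Qed.

HB.instance Definition _ := Measure_isSigmaFinite.Build _ _ _ (@lebesgue_tuple n)
  lebesgue_tuple_sigma_finite.

End instances.

Lemma lebesgue_tuple_box n (A : 'I_n -> set (measurableTypeR R)) :
  (forall i, measurable (A i)) ->
  lebesgue_tuple [set x : n.-tuple _ | forall i, A i (tnth x i)] =
  \prod_(i < n) lebesgue_measure (A i).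
Proof.
elim: n A => [|n IH] A mA.
  rewrite big_ord0 /= diracE mem_set//; first by case.
rewrite big_ord_recl -IH//= /pushforward -product_measure1E//=; last first.
  rewrite (_ : [set _ | _] = \bigcap_(i in [set: 'I_n])
    ((fun x : n.-tuple (measurableTypeR R) => tnth x i) @^-1` A (lift ord0 i))).
    apply: fin_bigcap_measurable; first exact: finite_finset.
    by move=> i _; rewrite -[X in measurable X]setTI; exact: measurable_tnth.
  by apply/seteqP; split => [x xA i _|x xA i]; [exact: xA|exact: (xA i)].
congr (_ \x _)%E; apply/seteqP; split => -[x t] /=.
  move=> xA; split => [|i]; first exact: (xA ord0).
  by have := xA (lift ord0 i); rewrite tnthS.
move=> [xA tA] i; case: (unliftP ord0 i) => [j|] ->//.
by rewrite tnthS.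
Qed.

End LebesgueTuple.
Arguments lebesgue_tuple {R} n.

(* Main.v *)
Require Import Defs.
From mathcomp Require Import all_boot all_order all_algebra finmap.
From mathcomp Require Import -(notations) mpoly.
From mathcomp Require Import all_classical all_reals all_analysis.
From mathcomp Require Import measurable_realfun.

(* By translation invariance of Lebesgue measure, the integral of p over B(c, r) is
   Q(c) = \int_{B(0, r)} p(c + y) dy. As a function of c this is a polynomial
   whose top degree part is vol(B) times that of p. So Q has degree at most d,
   vanishes on Xi, and is 0 by unisolvence; since vol(B) <> 0, so is p. *)

Set Implicit Arguments.
Unset Strict Implicit.
Unset Printing Implicit Defensive.

Import Order.TTheory GRing.Theory Num.Theory.
Import numFieldNormedType.Exports.
Local Open Scope classical_set_scope.
Local Open Scope ring_scope.

(** * Translation invariance of Lebesgue measure and change of variables *)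

Section Translation.
Context (R : realType).
Local Notation T := (measurableTypeR R).

Lemma measurable_addl (c : R) : measurable_fun [set: T] ((fun x => c + x) : T -> T).
Proof. by apply: measurable_funD => //; exact: measurable_cst. Qed.

(** The pushforward of Lebesgue measure under a translation gives []a, b]] its length, so uniqueness
    of Lebesgue measure applies. *)
Lemma lebesgue_measure_addl (c : R) (A : set T) : measurable A ->
  lebesgue_measure ((fun x => c + x) @^-1` A) = lebesgue_measure A.
Proof.
pose mu := measure_function_pushforward__canonical__measure_function_Measure
    (@lebesgue_measure R) (measurable_addl c).
move=> mA; apply/esym.
apply: (lebesgue_measure_unique (mu := mu)) => // X [[a b] _ <-] /=.
rewrite /pushforward.
have -> : (fun x => c + x) @^-1` `]a, b] = `]a - c, b - c]%classic.
  by apply/seteqP; split => x /=; rewrite !in_itv /= ltrBlDl lerBrDl.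
rewrite !lebesgue_measure_itv /= !lte_fin ltrD2r; case: ifP => // _.
by rewrite -!EFinD opprB addrA subrK.
Qed.

Definition addt n (c : n.-tuple R) (x : n.-tuple T) : n.-tuple T :=
  [tuple tnth c i + tnth x i | i < n].

Lemma measurable_addt n (c : n.-tuple R) : measurable_fun setT (addt c).
Proof.
apply/measurable_fun_tnthP => i /=.
rewrite [X in measurable_fun _ X](_ : _ = (fun x => tnth c i + x) \o (fun x => tnth x i)).
  apply: measurableT_comp; first exact: measurable_addl.
  exact: measurable_tnth.
by apply/funext => x /=; rewrite tnth_mktuple.
Qed.

Lemma addt_tcons n (a : R) (c : n.-tuple R) (xt : T * n.-tuple T) :
  addt [tuple of a :: c] (tcons xt) = tcons (a + xt.1, addt c xt.2).
Proof.
apply: eq_from_tnth => i; rewrite tnth_mktuple.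
by case: (unliftP ord0 i) => [j|] ->; rewrite ?tnth0 ?tnthS// tnth_mktuple.
Qed.

(** Induction on the dimension by slicing along the first coordinate: the induction hypothesis
    removes the shift inside each slice, and invariance on the line removes the shift of the slicing
    variable. *)
Lemma lebesgue_tuple_addt n (c : n.-tuple R) (A : set (n.-tuple T)) :
  measurable A ->
  lebesgue_tuple n (addt c @^-1` A) = lebesgue_tuple n A.
Proof.
elim: n c A => [|n IH] c A mA /=.
  rewrite !diracE; congr (((_ : bool)%:R)%:E).
  by apply/idP/idP; rewrite !inE /= (tuple0 (addt _ _)).
case/tupleP: c => a c; rewrite /pushforward /product_measure1.
pose B := @tcons R n @^-1` A.
have mB : measurable B.
  by rewrite -[B]setTI; exact: measurable_tcons.
pose F := fun x : T => lebesgue_tuple n (xsection B x).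
transitivity (\int[@lebesgue_measure R]_x F (a + x)%R)%E.
  apply: eq_integral => x _ /=.
  rewrite /F -(IH c (xsection B (a + x)%R)); last exact: measurable_xsection.
  by congr (lebesgue_tuple n _); apply/seteqP; split => t /=;
    rewrite /xsection /= !inE /B /= addt_tcons.
have mF : measurable_fun setT F by exact: measurable_fun_xsection.
have -> : (\int[@lebesgue_measure R]_x F (a + x)%R =
    \int[pushforward (@lebesgue_measure R) ((fun x => (a + x)%R) : T -> T)]_x F x)%E.
  by rewrite (ge0_integral_pushforward (measurable_addl a))// => x _; exact: measure_ge0.
pose mu := measure_function_pushforward__canonical__measure_function_Measure
    (@lebesgue_measure R) (measurable_addl a).
apply: (eq_measure_integral (@lebesgue_measure R) (m1 := mu)) => C mC _.
exact: lebesgue_measure_addl.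
Qed.

(** By invariance, Lebesgue measure may be replaced by its pushforward under [addt c]. Integrability
    is asked on the translated side, which for a ball [D] centred at [c] is the ball at the
    origin. *)
Lemma Rintegral_addt n (c : n.-tuple R) (D : set (n.-tuple T)) (f : n.-tuple T -> R) :
  measurable D -> measurable_fun setT f ->
  (lebesgue_tuple n).-integrable (addt c @^-1` D) (EFin \o f \o addt c) ->
  \int[lebesgue_tuple n]_(x in D) f x =
  \int[lebesgue_tuple n]_(x in addt c @^-1` D) f (addt c x).
Proof.
move=> mD mf intf.
pose mu := measure_function_pushforward__canonical__measure_function_Measure
    (@lebesgue_tuple R n) (measurable_addt c).
rewrite /Rintegral; congr fine.
rewrite -(eq_measure_integral (@lebesgue_tuple R n) (m1 := mu)); last first.
  by move=> A mA _; exact: lebesgue_tuple_addt.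
rewrite /mu /= (integral_pushforward (measurable_addt c))//.
exact/measurable_EFinP.
Qed.

End Translation.

(** * Measurability and volume of boxes and Euclidean balls *)

Lemma measurable_box (R : realType) n (A : 'I_n -> set (measurableTypeR R)) :
  (forall i, measurable (A i)) ->
  measurable [set x : n.-tuple (measurableTypeR R) | forall i, A i (tnth x i)].
Proof.
move=> mA; rewrite (_ : [set _ | _] = \bigcap_(i in [set: 'I_n])
    ((fun x : n.-tuple (measurableTypeR R) => tnth x i) @^-1` A i)).
  apply: fin_bigcap_measurable; first exact: finite_finset.
  by move=> i _; rewrite -[X in measurable X]setTI; exact: measurable_tnth.
by apply/seteqP; split => [x xA i _|x xA i]; [exact: xA|exact: (xA i)].
Qed.

Section Ball.
Context (R : realType) (n : nat) (r : R).
Hypothesis r_ge0 : 0 <= r.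
Local Notation T := (measurableTypeR R).
Implicit Types (c x : n.-tuple R).

Lemma eballE c :
  eball c r = [set x : n.-tuple R | \sum_(i < n) (tnth x i - tnth c i) ^+ 2 <= r ^+ 2].
Proof.
rewrite -[X in eball c X](ger0_norm r_ge0) -sqrtr_sqr.
by apply/seteqP; split => x; rewrite /eball /= ler_sqrt// sqr_ge0.
Qed.

Lemma measurable_eball c : measurable (eball c r : set (n.-tuple T)).
Proof.
rewrite eballE.
pose s := fun x : n.-tuple T => \sum_(i < n) (tnth x i - tnth c i) ^+ 2.
have ms : measurable_fun setT s.
  apply: measurable_sum => i; apply: measurable_funX; apply: measurable_funB.
    exact: measurable_tnth.
  exact: measurable_cst.
rewrite -[X in measurable X]setTI (_ : [set _ | _] = s @^-1` `]-oo, r ^+ 2]%classic).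
  by apply: ms => //; exact: measurable_itv.
by apply/seteqP; split => x; rewrite /= in_itv.
Qed.

Definition origin : n.-tuple R := [tuple 0 | i < n].

Lemma preimage_addt_eball c : addt c @^-1` (eball c r) = eball origin r.
Proof.
by apply/seteqP; split => x; rewrite /= /eball /=; congr (Num.sqrt _ <= _);
  apply: eq_bigr => i _; rewrite !tnth_mktuple subr0 (addrC (tnth c i)) addrK.
Qed.

Lemma eball_tnth_le x i : eball origin r x -> `|tnth x i| <= r.
Proof.
rewrite eballE /= (bigD1 i)//= tnth_mktuple subr0 => xr.
rewrite -(ler_pXn2r (ltn0Sn 1)) ?nnegrE//= real_normK ?num_real//.
by apply: le_trans xr; rewrite lerDl sumr_ge0// => j _; exact: sqr_ge0.
Qed.

(** The ball lies in the cube [[-r, r]^n]. *)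
Lemma lebesgue_tuple_eball_lty : (lebesgue_tuple n (eball origin r) < +oo)%E.
Proof.
pose A (_ : 'I_n) : set T := `[-r, r]%classic.
have mA i : measurable (A i) by exact: measurable_itv.
apply: (@le_lt_trans _ _
    (lebesgue_tuple n [set x : n.-tuple T | forall i, A i (tnth x i)])).
  apply: le_measure; rewrite ?inE//; first exact: measurable_eball.
    exact: measurable_box.
  by move=> x /= xr i; rewrite /A /= in_itv /= -ler_norml; exact: eball_tnth_le.
rewrite lebesgue_tuple_box// ltey_eq; apply/orP; left.
elim/big_ind : _ => // [x y|i _]; first exact: fin_numM.
by rewrite /A lebesgue_measure_itv; case: ifP.
Qed.

Lemma lebesgue_tuple_eball_gt0 : 0 < r ->
  (0 < lebesgue_tuple n (eball origin r))%E.
Proof.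
move=> r_gt0.
(* The cube [[-e, e]^n] lies in the ball since [n * e^2 <= r^2], that is, [n <= (n+1)^2]. Taking
   [n.+1] keeps the denominator nonzero for every [n]. *)
pose e := r / n.+1%:R.
have e_gt0 : 0 < e by rewrite divr_gt0.
pose A (_ : 'I_n) : set T := `[-e, e]%classic.
have mA i : measurable (A i) by exact: measurable_itv.
apply: (@lt_le_trans _ _
    (lebesgue_tuple n [set x : n.-tuple T | forall i, A i (tnth x i)])).
  rewrite lebesgue_tuple_box//; elim/big_ind : _ => [|x y x0 y0|i _].
  - exact: lte01.
  - exact: mule_gt0.
  rewrite /A lebesgue_measure_itv /= !lte_fin gtrN// -EFinD opprK lte_fin.
  exact: addr_gt0.
apply: le_measure; rewrite ?inE//; first exact: measurable_box.
  exact: measurable_eball.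
move=> x /= xA; rewrite eballE /=.
apply: (@le_trans _ _ (\sum_(i < n) e ^+ 2)).
  apply: ler_sum => i _; rewrite tnth_mktuple subr0 -real_normK ?num_real//.
  rewrite ler_pXn2r ?nnegrE ?(ltW e_gt0)//.
  by have := xA i; rewrite /A /= in_itv /= -ler_norml.
rewrite sumr_const card_ord -mulr_natl /e expr_div_n mulrCA ger_pMr ?exprn_gt0//.
rewrite ler_pdivrMr ?exprn_gt0// mul1r expr2 -natrM ler_nat.
by rewrite mulSn leqW// leq_addr.
Qed.

End Ball.

(** * Integrals of translated polynomials as polynomials in the translation *)

Lemma multinom_ind n (P : multinom n -> Prop) :
  P mnm0 -> (forall i m, P m -> P (mnm_add m (mnm1 i))) -> forall m, P m.
Proof.
move=> P0 PS m; have [k] := ubnP (mdeg m); elim: k m => // k IH m.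
have [/eqP|m0 mk] := boolP (mdeg m == 0%N).
  by move/eqP; rewrite mdeg_eq0 => /eqP ->.
(* A nonzero multi-index has a positive entry; removing one unit from it lowers the total degree. *)
have [i mi] : exists i, m i != 0%N.
  apply/existsP; apply: contraNT m0; rewrite negb_exists => /forallP mz.
  rewrite mdeg_eq0; apply/eqP/mnmP => i; rewrite mnm0E; apply/eqP.
  by move: (mz i); rewrite negbK.
have im : mpoly.lem (mnm1 i) m.
  by apply/mnm_lepP => j; rewrite mnm1E; case: eqP => // <-; rewrite lt0n.
rewrite -(submK im); apply/PS/IH.
by move: mk; rewrite -{1}(submK im) mdegD mdeg1 addn1 ltnS.
Qed.

Section BoundedMeasurable.
Context (R : realType) (n : nat) (D : set (n.-tuple (measurableTypeR R))).
Local Notation T := (n.-tuple (measurableTypeR R)).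

(** The bound is required on [D] only, since polynomials are in general unbounded on the whole
    space. This class is stable under sums and products, and gives integrability when [D] has finite
    measure. *)
Definition bounded_measurable (g : T -> R) : Prop :=
  measurable_fun setT g /\ exists M, forall x, D x -> `|g x| <= M.

Lemma bounded_measurable_cst a : bounded_measurable (fun=> a).
Proof. by split; [exact: measurable_cst|exists `|a|]. Qed.

Lemma bounded_measurableD f g : bounded_measurable f -> bounded_measurable g ->
  bounded_measurable (fun x => f x + g x).
Proof.
move=> [mf [A fA]] [mg [B gB]]; split; first exact: measurable_funD.
by exists (A + B) => x Dx; rewrite (le_trans (ler_normD _ _))// lerD ?fA ?gB.
Qed.

Lemma bounded_measurableM f g : bounded_measurable f -> bounded_measurable g ->
  bounded_measurable (fun x => f x * g x).
Proof.
move=> [mf [A fA]] [mg [B gB]]; split; first exact: measurable_funM.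
by exists (A * B) => x Dx; rewrite normrM ler_pM ?fA ?gB.
Qed.

(** The evaluation point [u x] is arbitrary so as to cover both [x] itself and its translates
    [addt c x]. *)
Lemma bounded_measurable_meval (u : T -> 'I_n -> R) (p : mpoly n R) :
  (forall i, bounded_measurable (u^~ i)) ->
  bounded_measurable (fun x => meval (u x) p).
Proof.
move=> bu; elim/mpolyind: p => [|a m p _ _ bp].
  rewrite (_ : (fun _ => _) = fun=> 0); first exact: bounded_measurable_cst.
  by apply/funext => x; rewrite meval0.
rewrite (_ : (fun _ => _) = fun x => a * meval (u x) (mpolyX R m) + meval (u x) p).
  apply: bounded_measurableD => //; apply: bounded_measurableM.
    exact: bounded_measurable_cst.
  elim/multinom_ind: m => [|i m bm].
    rewrite (_ : (fun _ => _) = fun=> 1); first exact: bounded_measurable_cst.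
    by apply/funext => x; rewrite mpolyX0 meval1.
  rewrite (_ : (fun _ => _) = fun x => meval (u x) (mpolyX R m) * u x i).
    exact: bounded_measurableM.
  by apply/funext => x; rewrite mpolyXD mevalM mevalXU.
by apply/funext => x; rewrite mevalD mevalZ.
Qed.

Hypotheses (mD : measurable D) (Doo : (lebesgue_tuple n D < +oo)%E).

Lemma bounded_measurable_integrable g : bounded_measurable g ->
  (lebesgue_tuple n).-integrable D (EFin \o g).
Proof.
move=> [mg [M gM]]; apply: measurable_bounded_integrable => //.
  exact: measurable_funTS.
exists M; split; [exact: num_real|move=> N MN x Dx].
exact: le_trans (gM x Dx) (ltW MN).
Qed.

Hypothesis bD : forall i, bounded_measurable (fun x => tnth x i).

Lemma bounded_measurable_addt (c : n.-tuple R) i :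
  bounded_measurable (fun x => tnth (addt c x) i).
Proof.
rewrite (_ : (fun _ => _) = fun x : T => tnth c i + tnth x i).
  by apply: bounded_measurableD => //; exact: bounded_measurable_cst.
by apply/funext => x; rewrite tnth_mktuple.
Qed.

(* Carrying an arbitrary weight g lets the induction on m absorb each factor
   c_i + y_i: the c_i comes out of the integral, and the y_i goes into g. *)
Lemma Rintegral_addt_mpolyX (m : multinom n) (g : T -> R) : bounded_measurable g ->
  exists2 Q : mpoly n R,
    forall c : n.-tuple R,
      \int[lebesgue_tuple n]_(y in D) (meval (tnth (addt c y)) (mpolyX R m) * g y) =
      meval (tnth c) Q
  & (msize (Q - (\int[lebesgue_tuple n]_(y in D) g y) *: mpolyX R m) <= mdeg m)%N.
Proof.
elim/multinom_ind: m g => [|i m IH] g bg.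
  exists ((\int[lebesgue_tuple n]_(y in D) g y) *: mpolyX R mnm0).
    move=> c; rewrite mpolyX0 mevalZ meval1 mulr1; apply: eq_Rintegral => y _.
    by rewrite meval1 mul1r.
  by rewrite subrr msize0.
have [Q QE szQ] := IH _ bg.
have bgi : bounded_measurable (fun y => tnth y i * g y) by exact: bounded_measurableM.
have [Q' Q'E szQ'] := IH _ bgi.
exists (Q * mpolyX R (mnm1 i) + Q') => [c|].
  rewrite mevalD mevalM mevalXU -QE -Q'E mulrC.
  have int f : bounded_measurable f -> (lebesgue_tuple n).-integrable D
      (EFin \o (fun y => meval (tnth (addt c y)) (mpolyX R m) * f y)).
    move=> bf; apply/bounded_measurable_integrable/bounded_measurableM => //.
    by apply: bounded_measurable_meval => j; exact: bounded_measurable_addt.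
  rewrite -RintegralZl//; last exact: int.
  rewrite -RintegralD//.
  - apply: eq_Rintegral => y _; rewrite mpolyXD mevalM mevalXU tnth_mktuple.
    by rewrite -mulrA mulrDl mulrDr mulrCA.
  - have := int _ (bounded_measurableM (bounded_measurable_cst (tnth c i)) bg).
    by congr (_.-integrable _ _); apply/funext => y /=; rewrite mulrCA.
  - exact: int.
(* As [msize] is the degree plus one, the claim is that the error has degree below that of the
   monomial. Multiplying by the new variable raises the old error by one degree, and [Q'] has degree
   at most [mdeg m], so it belongs entirely to the new error. *)
rewrite mpolyXD scalerAl addrAC -mulrBl mdegD mdeg1 addn1.
rewrite (leq_trans (msizeD_le _ _))// geq_max; apply/andP; split.
  (* The size formula for a product needs nonzero factors. *)
  have [->|Q0] := eqVneq (Q - (\int[lebesgue_tuple n]_(y in D) g y) *: mpolyX R m) 0.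
    by rewrite mul0r msize0.
  rewrite msizeM// ?msizeX ?mdeg1 ?addn2//.
  by rewrite -msize_poly_eq0 msizeX.
have -> : Q' = Q' - (\int[lebesgue_tuple n]_(y in D) (tnth y i * g y)) *: mpolyX R m
    + (\int[lebesgue_tuple n]_(y in D) (tnth y i * g y)) *: mpolyX R m by rewrite subrK.
rewrite (leq_trans (msizeD_le _ _))// geq_max (leq_trans szQ')//=.
by rewrite (leq_trans (msizeZ_le _ _))// msizeX.
Qed.

(** Sum of the monomial case over the support of [p]. The size bound says that [Q] and [vol(D) p]
    agree in top degree; for [p = 0] it forces [Q = 0]. *)
Lemma Rintegral_addt_mpoly (p : mpoly n R) :
  exists2 Q : mpoly n R,
    forall c : n.-tuple R,
      \int[lebesgue_tuple n]_(y in D) meval (tnth (addt c y)) p = meval (tnth c) Q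
  & (msize (Q - fine (lebesgue_tuple n D) *: p) <= (msize p).-1)%N.
Proof.
have : all (fun m => mdeg m <= (msize p).-1)%N (msupp p).
  apply/allP => m /msize_mdeg_lt; case: (msize p) => //.
(* With the bound frozen as [k] and the coefficients still read off [p], the induction can run over
   the list of monomials alone. *)
move: (msize p).-1 => k; rewrite [in exists2 _, _ & _](mpolyE p).
elim: (msupp p) => [_|m s IH /= /andP[mk sk]].
  exists 0 => [c|]; last by rewrite big_nil scaler0 subr0 msize0.
  by rewrite meval0 /Rintegral integral0_eq// => y _; rewrite big_nil meval0.
have [Q QE szQ] := IH sk.
(* The coefficient is used as a constant weight; its integral is the coefficient times the volume of
   [D]. *)
have [Qm QmE szQm] := Rintegral_addt_mpolyX m (bounded_measurable_cst (mcoeff m p)).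
exists (Qm + Q) => [c|].
  have int q : bounded_measurable (fun y => meval (tnth (addt c y)) q).
    by apply: bounded_measurable_meval => j; exact: bounded_measurable_addt.
  rewrite mevalD -QmE -QE -RintegralD//.
  - by apply: eq_Rintegral => y _; rewrite big_cons mevalD mevalZ mulrC.
  - apply/bounded_measurable_integrable/bounded_measurableM => //.
    exact: bounded_measurable_cst.
  - exact: bounded_measurable_integrable.
rewrite big_cons scalerDr opprD addrACA (leq_trans (msizeD_le _ _))// geq_max szQ andbT.
rewrite (leq_trans _ mk)// scalerA; apply: leq_trans szQm.
by rewrite Rintegral_cst// mulrC.
Qed.

End BoundedMeasurable.

(** * Vanishing of [Q] by unisolvence, and hence of [p] *)

Theorem theorem2p2 (R : realType) (n d : nat) (Xi : {fset n.-tuple R}) (r : R)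
    (p : polyle n R d) :
  (1 <= n)%N ->
  unisolvent d Xi ->
  0 < r ->
  (forall xi : n.-tuple R, xi \in Xi ->
    (\int[lebesgue_tuple n]_(x in eball xi r) (meval (tnth x) p)%:E = 0)%E) ->
  p = 0.
Proof.
move=> _ [_ uni] r_gt0 intp0.
have r_ge0 := ltW r_gt0.
pose D : set (n.-tuple (measurableTypeR R)) := eball (origin R n) r.
have mD : measurable D by exact: measurable_eball.
have Doo : (lebesgue_tuple n D < +oo)%E by exact: lebesgue_tuple_eball_lty.
(* This serves twice: for the ball [D], and for [set0], where the bound is vacuous. *)
have bT (E : set (n.-tuple (measurableTypeR R))) i :
    (forall x, E x -> `|tnth x i| <= r) ->
    bounded_measurable E (fun x => tnth x i).
  by move=> Er; split; [exact: measurable_tnth|exists r].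
have bD i : bounded_measurable D (fun x => tnth x i).
  by apply: bT => x; exact: eball_tnth_le.
have [Q QE szQ] := Rintegral_addt_mpoly mD Doo bD p.
(* Finiteness matters as well as positivity, because [fine] sends [+oo] to 0. *)
have vD : fine (lebesgue_tuple n D) != 0.
  by rewrite gt_eqF// fine_gt0// Doo lebesgue_tuple_eball_gt0.
have dp : (msize p <= d.+1)%N by have := valP p.
have dQ : Q \in deg_le d.
  rewrite inE -[Q](subrK (fine (lebesgue_tuple n D) *: (p : mpoly n R))).
  rewrite (leq_trans (msizeD_le _ _))// geq_max.
  rewrite (leq_trans szQ)/= ?(leq_trans (leq_pred _))//.
  exact: leq_trans (msizeZ_le _ _) dp.
have /(congr1 val)/= Q0 : PolyLe dQ = 0.
  apply: uni => xi /intp0 intp; rewrite /= -QE.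
  transitivity (\int[lebesgue_tuple n]_(x in eball xi r) meval (tnth x) p).
    rewrite [RHS](Rintegral_addt (c := xi)).
    - by rewrite preimage_addt_eball.
    - exact: measurable_eball.
    - (* bounded_measurable set0 is plain measurability *)
      have [] // : bounded_measurable set0
          (fun x : n.-tuple (measurableTypeR R) => meval (tnth x) p).
      by apply: bounded_measurable_meval => i; apply: bT.
    - rewrite preimage_addt_eball; apply: bounded_measurable_integrable => //.
      by apply: bounded_measurable_meval => i; exact: bounded_measurable_addt.
  by rewrite /Rintegral intp.
(* With [Q = 0] the bound becomes [msize p <= (msize p).-1], which holds only for size 0. *)
move: szQ; rewrite Q0 sub0r -scaleNr msizeZ ?oppr_eq0// => szp.
apply: val_inj => /=; apply/eqP; rewrite -msize_poly_eq0.
by move: szp; case: (msize p) => // k; rewrite ltnn.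
Qed.
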